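(* Let $d\ge1$, $\alpha\in\mathbb R$, and let $u\in\mathcal G(\mathbb R^d\setminus\{0\})$ be homogeneous of degree $\alpha$, i.e. $u(\lambda x)=\lambda^\alpha u(x)$ in $\mathcal G(\mathbb R^d\setminus\{0\})$ for every $\lambda\in\mathbb R^+$. Let $K:\mathcal G_\tau(\mathbb R^d)\to\mathcal G(\mathbb R^d)$ be the canonical map. Then there exists $v\in\mathcal G_\tau(\mathbb R^d)$ such that $K(v)|_{\mathbb R^d\setminus\{0\}}=u$ in $\mathcal G(\mathbb R^d\setminus\{0\})$.
   Context: For $\Omega\subseteq\mathbb R^d$ open, the special Colombeau algebra is $\mathcal G(\Omega):=\mathcal E_M(\Omega)/\mathcal N(\Omega)$, where $\mathcal E_M(\Omega)$ is the set of nets $(u_\varepsilon)_{\varepsilon\in(0,1]}$ of (complex-valued) functions in $C^\infty(\Omega)$ such that for every compact $L\subset\Omega$ and every $\beta\in\mathbb N_0^d$ there is $N\ge 0$ with $\sup_{x\in L}|\partial^\beta u_\varepsilon(x)|=O(\varepsilon^{-N})$ as $\varepsilon\to 0$, and $\mathcal N(\Omega)$ is the set of nets such that for every compact $L\subset \Omega$, every $\beta\in\mathbb N_0^d$ and every $m\ge 0$, $\sup_{x\in L}|\partial^\beta u_\varepsilon(x)|=O(\varepsilon^{m})$ as $\varepsilon\to 0$. Operations and restrictions are componentwise on representatives; $u(\lambda x)$ is the class of $(x\mapsto u_\varepsilon(\lambda x))_\varepsilon$; $\mathbb R^+=(0,\infty)$. The algebra of tempered generalized functions is $\mathcal G_\tau(\Omega):=\mathcal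 E_{M,\tau}(\Omega)/\mathcal N_\tau(\Omega)$, where $\mathcal E_{M,\tau}(\Omega)$ is the set of nets $(u_\varepsilon)_\varepsilon$ in $C^\infty(\Omega)$ such that for every $\beta\in\mathbb N_0^d$ there is $N$ with $\sup_{x\in\Omega}(1+|x|)^{-N}|\partial^\beta u_\varepsilon(x)|=O(\varepsilon^{-N})$ as $\varepsilon\to0$, and $\mathcal N_\tau(\Omega)$ is the set of nets such that for every $\beta\in\mathbb N_0^d$ there is $N$ such that for all $p$, $\sup_{x\in\Omega}(1+|x|)^{-N}|\partial^\beta u_\varepsilon(x)|=O(\varepsilon^{p})$ as $\varepsilon\to0$. The canonical map $K:\mathcal G_\tau(\Omega)\to\mathcal G(\Omega)$ sends the class of $(u_\varepsilon)_\varepsilon$ modulo $\mathcal N_\tau(\Omega)$ to its class modulo $\mathcal N(\Omega)$. *)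

(* Defs.v *)
(* MathComp-Analysis, with the complex numbers R[i] of mathcomp-real-closed. *)
From HB Require Import structures.
From mathcomp Require Import all_boot all_order all_algebra complex.
From mathcomp Require Import all_classical all_reals all_analysis.

Set Implicit Arguments.
Unset Strict Implicit.
Unset Printing Implicit Defensive.

Import Order.TTheory GRing.Theory Num.Theory.
Import numFieldNormedType.Exports.
Import ComplexField.Normc.

Local Open Scope classical_set_scope.
Local Open Scope ring_scope.
Local Open Scope complex_scope.
Local Open Scope quotient_scope.

Lemma near_eq_differentiable (R : numFieldType) (V W : normedModType R)
    (f g : V -> W) (x : V) :
  {near x, f =1 g} -> differentiable f x -> differentiable g x.
Proof.
move=> fg df.
have dfc := diff_continuous df.
have gdf : g \o shift x = cst (g x) + 'd f x +o_ 0 id.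
  apply/eqaddoP => _/posnumP[eps].
  have /eqaddoP/(_ eps%:num (gt0 eps)) := diff_locally df.
  have fg0 : \forall h \near 0, f (h + x) = g (h + x).
    by have := fg; rewrite (near_shift 0 x)/= subr0.
  apply: filterS2 fg0 => h fgh.
  by rewrite !fctE/= fgh (nbhs_singleton fg).
by apply/diff_locallyP; rewrite (diff_unique dfc gdf).
Qed.

Lemma differentiable_dil (R : numFieldType) (V W : normedModType R)
    (f : V -> W) (l : R) (x : V) :
  differentiable f (l *: x) -> differentiable (fun y => f (l *: y)) x.
Proof.
by move=> df; apply: (@differentiable_comp _ _ _ _ ( *:%R l)).
Qed.

Lemma derive_dil (R : numFieldType) (V W : normedModType R)
    (f : V -> W) (l : R) (x v : V) :
  differentiable f (l *: x) ->
  'D_v (fun y => f (l *: y)) x = l *: 'D_v f (l *: x).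
Proof.
move=> df; have dl : differentiable ( *:%R l : V -> V) x.
  exact: (@differentiableZ _ _ _ id l).
rewrite (deriveE _ df) (deriveE _ (differentiable_dil df)).
have dlE : 'd ( *:%R l) x = ( *:%R l) :> (V -> V).
  exact: (diff_lin x (@scaler_continuous _ _ l)).
have /(congr1 (@^~ v)) /= := diff_comp dl df.
by rewrite dlE linearZ.
Qed.

Section RealPartials.
Variables (R : realType) (d : nat).
Implicit Types (U V : set 'rV[R]_d) (f g : 'rV[R]_d -> R) (s : seq 'I_d).

Definition partial (i : 'I_d) f : 'rV[R]_d -> R :=
  fun x => 'D_('e_i) f x.

Definition partials s f : 'rV[R]_d -> R := foldr partial f s.

(* Infinite differentiability on U: every iterated partial derivative, in every
   order of the directions, is Frechet differentiable at every point of U. *)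
Definition rsmooth U f :=
  forall s x, U x -> differentiable (partials s f) x.

Lemma partials_eq U f g s : open U -> {in U, f =1 g} ->
  {in U, partials s f =1 partials s g}.
Proof.
move=> oU fg; elim: s => [//|i s IH] x xU; rewrite /= /partial.
apply: near_eq_derive; have := open_nbhs_nbhs (conj oU (set_mem xU)).
by apply: filterS => y yU; apply/IH/mem_set.
Qed.

Lemma partials_lin U f g (a b : R) s : open U -> rsmooth U f -> rsmooth U g ->
  {in U, partials s (a \*: f \+ b \*: g) =1
         (a \*: partials s f \+ b \*: partials s g)}.
Proof.
move=> oU sf sg; elim: s => [//|i s IH] x /set_mem xU; rewrite /= /partial.
transitivity ('D_('e_i) (a \*: partials s f \+ b \*: partials s g) x).
  apply: near_eq_derive; have := open_nbhs_nbhs (conj oU xU).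
  by apply: filterS => y yU; apply/IH/mem_set.
have df : derivable (partials s f) x 'e_i by apply/diff_derivable/sf.
have dg : derivable (partials s g) x 'e_i by apply/diff_derivable/sg.
rewrite deriveD; [|exact: derivableZ..].
by congr (_ + _); exact: deriveZ.
Qed.

Lemma rsmooth_lin U f g (a b : R) : open U -> rsmooth U f -> rsmooth U g ->
  rsmooth U (a \*: f \+ b \*: g).
Proof.
move=> oU sf sg s x xU.
apply: (@near_eq_differentiable _ _ _ (a \*: partials s f \+ b \*: partials s g)).
  have := open_nbhs_nbhs (conj oU xU); apply: filterS => y yU.
  by rewrite (partials_lin a b s oU sf sg)//; exact/mem_set.
by apply: differentiableD; apply: differentiableZ; [exact: sf|exact: sg].
Qed.

Lemma partials_dil U V f (l : R) s : open V ->
  (forall x : 'rV[R]_d, V x -> U (l *: x)) -> rsmooth U f ->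
  {in V, partials s (fun x => f (l *: x)) =1
         (fun x => l ^+ size s * partials s f (l *: x))}.
Proof.
move=> oV VU sf; elim: s => [|i s IH] x /set_mem xV; first by rewrite /= mul1r.
rewrite /= /partial.
transitivity ('D_('e_i) (l ^+ size s \*: (fun y => partials s f (l *: y))) x).
  apply: near_eq_derive; have := open_nbhs_nbhs (conj oV xV).
  by apply: filterS => y yV; rewrite IH//; exact/mem_set.
have dU : differentiable (partials s f) (l *: x) by apply: sf; exact: VU.
rewrite deriveZ; last exact/diff_derivable/differentiable_dil.
by rewrite derive_dil// /GRing.scale/= exprSr mulrA.
Qed.

Lemma rsmooth_dil U V f (l : R) : open V ->
  (forall x : 'rV[R]_d, V x -> U (l *: x)) -> rsmooth U f ->
  rsmooth V (fun x => f (l *: x)).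
Proof.
move=> oV VU sf s x xV.
apply: (@near_eq_differentiable _ _ _
    ((l ^+ size s) \*: (fun y => partials s f (l *: y)))).
  have := open_nbhs_nbhs (conj oV xV); apply: filterS => y yV.
  by rewrite (partials_dil s oV VU sf)//; exact/mem_set.
by apply: differentiableZ; apply: differentiable_dil; apply: sf; exact: VU.
Qed.

End RealPartials.

Section LmodQuotient.
Variables (K : pzRingType) (V : lmodType K) (I : zmodClosed V).
Hypothesis I_scale : scaler_closed I.

Definition lquot of scaler_closed I : Type := Quotient.quot I.
Local Notation Q := (lquot I_scale).
HB.instance Definition _ := EqQuotient.on Q.
HB.instance Definition _ := GRing.Zmodule.on Q.

Lemma lquot_eqP (x y : V) : (\pi_Q x = \pi_Q y) <-> (x - y \in I).
Proof. by rewrite Quotient.idealrBE; split=> /eqP. Qed.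

(* Maps on quotients are applied to the representative (repr x); the lemmas
   with suffix _pi show that any representative gives the same class. *)
Definition lquot_scale (a : K) (x : Q) : Q := \pi_Q (a *: repr x).

Lemma lquot_scale_pi a x : lquot_scale a (\pi_Q x) = \pi_Q (a *: x).
Proof.
apply/lquot_eqP; rewrite -scalerBr; apply: I_scale.
by apply/lquot_eqP; rewrite reprK.
Qed.

Lemma lquot_pi_add x y : \pi_Q (x + y) = \pi_Q x + \pi_Q y.
Proof. exact: (Quotient.pi_add I). Qed.

Lemma lquot_scaleA a b x :
  lquot_scale a (lquot_scale b x) = lquot_scale (a * b) x.
Proof. by elim/quotW: x => x; rewrite (lquot_scale_pi b) !lquot_scale_pi scalerA. Qed.

Lemma lquot_scale1 : left_id 1 lquot_scale.
Proof. by elim/quotW=> x; rewrite lquot_scale_pi scale1r. Qed.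

Lemma lquot_scaleDr : right_distributive lquot_scale +%R.
Proof.
move=> a; elim/quotW=> x; elim/quotW=> y.
by rewrite -lquot_pi_add !lquot_scale_pi scalerDr lquot_pi_add.
Qed.

Lemma lquot_scaleDl x : {morph lquot_scale^~ x : a b / a + b}.
Proof.
by move=> a b; elim/quotW: x => x; rewrite !lquot_scale_pi scalerDl lquot_pi_add.
Qed.

HB.instance Definition _ := GRing.Zmodule_isLmodule.Build K Q
  lquot_scaleA lquot_scale1 lquot_scaleDr lquot_scaleDl.

End LmodQuotient.

Section Nets.
Variables (R : realType) (d : nat).
Local Notation V := 'rV[R]_d.
Local Notation C := (R[i]^o : lmodType R[i]).

(* |x| is the Euclidean norm; the norm of the library on 'rV[R]_d is the
   maximum norm. *)
Definition enorm (x : V) : R := Num.sqrt (\sum_(i < d) x 0 i ^+ 2).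

(* The multi-index beta is encoded by the list of directions
   0, ..., 0, 1, ..., 1, ... where i occurs (beta i) times. *)
Definition directions (beta : 'I_d -> nat) : seq 'I_d :=
  flatten [seq nseq (beta i) i | i <- enum 'I_d].

Definition cpartials (s : seq 'I_d) (f : V -> C) : V -> C := fun x =>
  partials s (fun y => complex.Re (f y)) x +i*
  partials s (fun y => complex.Im (f y)) x.

Definition mpartial (beta : 'I_d -> nat) (f : V -> C) : V -> C :=
  cpartials (directions beta) f.

Definition csmooth (U : set V) (f : V -> C) :=
  rsmooth U (fun y => complex.Re (f y)) /\
  rsmooth U (fun y => complex.Im (f y)).

(* sup_(x in A) g e x = O(r e) as e -> 0+.  The supremum is taken in the
   extended reals, so that the estimate forces it to be finite for small e (a
   supremum in R of an unbounded set would be 0). *)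
Definition sup_bigO (A : set V) (g : R -> V -> R) (r : R -> R) :=
  exists c : R, \forall e \near 0^'+,
    (ereal_sup [set (g e x)%:E | x in A] <= (c * r e)%:E)%E.

Lemma sup_bigOP A g r : (forall e, 0 < e -> 0 <= r e) ->
  sup_bigO A g r <->
  exists2 c : R, 0 <= c &
    \forall e \near 0^'+, forall x, A x -> g e x <= c * r e.
Proof.
move=> r0; split=> [[c cP]|[c c0 cP]].
  exists `|c| => //; near=> e => x Ax.
  have e0 : 0 < e by [].
  apply: (@le_trans _ _ (c * r e)); last by rewrite ler_wpM2r ?r0// ler_norm.
  rewrite -lee_fin; apply: le_trans (near cP e _); last by [].
  by apply: ereal_sup_ubound; exists x.
exists c; apply: filterS cP => e eP.
by apply: ge_ereal_sup => _ [x Ax <-]; rewrite lee_fin eP.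
Unshelve. all: by end_near. Qed.

(* A net (u_e), e in ]0, 1], is represented by a family over all e : R, and
   functions on U by functions on the whole space; the values for e outside
   ]0, 1] or x outside U are irrelevant and identified in the quotients below. *)
Local Notation net := (R -> V -> R[i]^o).

Definition smooth_net (U : set V) (u : net) :=
  forall e, 0 < e <= 1 -> csmooth U (u e).

Definition moderate (U : set V) (u : net) :=
  smooth_net U u /\
  forall L, compact L -> L `<=` U -> forall beta : 'I_d -> nat,
  exists N : nat,
    sup_bigO L (fun e x => normc (mpartial beta (u e) x)) (fun e => e ^- N).

Definition negligible_net (U : set V) (u : net) :=
  forall L, compact L -> L `<=` U -> forall (beta : 'I_d -> nat) (m : nat),
    sup_bigO L (fun e x => normc (mpartial beta (u e) x)) (fun e => e ^+ m).

Definition moderate_tau (U : set V) (u : net) :=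
  smooth_net U u /\
  forall beta : 'I_d -> nat, exists N : nat,
    sup_bigO U
      (fun e x => (1 + enorm x) ^- N * normc (mpartial beta (u e) x))
      (fun e => e ^- N).

Definition negligible_tau (U : set V) (u : net) :=
  forall beta : 'I_d -> nat, exists N : nat, forall p : nat,
    sup_bigO U
      (fun e x => (1 + enorm x) ^- N * normc (mpartial beta (u e) x))
      (fun e => e ^+ p).

Lemma csmooth_lin U (c : R[i]) (f g : V -> C) : open U ->
  csmooth U f -> csmooth U g -> csmooth U (c *: f + g).
Proof.
move=> oU [fr fi] [gr gi]; case: c => a b; split.
  have -> : (fun y => complex.Re (((a +i* b) *: f + g) y)) =
      1 \*: (a \*: (fun y => complex.Re (f y)) \+
         (- b) \*: (fun y => complex.Im (f y)))
      \+ 1 \*: (fun y => complex.Re (g y)).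
    apply/funext => y; rewrite !fctE /=; case: (f y) => x1 x2; case: (g y) => /=.
    by move=> y1 y2; rewrite /GRing.scale/= !mul1r mulNr.
  by apply: rsmooth_lin => //; apply: rsmooth_lin.
have -> : (fun y => complex.Im (((a +i* b) *: f + g) y)) =
    1 \*: (a \*: (fun y => complex.Im (f y)) \+
       b \*: (fun y => complex.Re (f y)))
    \+ 1 \*: (fun y => complex.Im (g y)).
  apply/funext => y; rewrite !fctE /=; case: (f y) => x1 x2; case: (g y) => /=.
  by move=> y1 y2; rewrite /GRing.scale/= !mul1r.
by apply: rsmooth_lin => //; apply: rsmooth_lin.
Qed.

Lemma cpartials_lin U (c : R[i]) (f g : V -> C) s : open U ->
  csmooth U f -> csmooth U g ->
  forall x, U x -> cpartials s (c *: f + g) x =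
                   c * cpartials s f x + cpartials s g x.
Proof.
move=> oU [fr fi] [gr gi] x Ux; case: c => a b; rewrite /cpartials.
have -> : (fun y => complex.Re (((a +i* b) *: f + g) y)) =
    1 \*: (a \*: (fun y => complex.Re (f y)) \+
       (- b) \*: (fun y => complex.Im (f y)))
    \+ 1 \*: (fun y => complex.Re (g y)).
  apply/funext => y; rewrite !fctE /=; case: (f y) => x1 x2; case: (g y) => /=.
  by move=> y1 y2; rewrite /GRing.scale/= !mul1r mulNr.
have -> : (fun y => complex.Im (((a +i* b) *: f + g) y)) =
    1 \*: (a \*: (fun y => complex.Im (f y)) \+
       b \*: (fun y => complex.Re (f y)))
    \+ 1 \*: (fun y => complex.Im (g y)).
  apply/funext => y; rewrite !fctE /=; case: (f y) => x1 x2; case: (g y) => /=.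
  by move=> y1 y2; rewrite /GRing.scale/= !mul1r.
have Ux' := mem_set Ux.
rewrite (partials_lin 1 1 s oU (rsmooth_lin _ _ oU fr fi) gr Ux').
rewrite (partials_lin 1 1 s oU (rsmooth_lin _ _ oU fi fr) gi Ux').
rewrite /= (partials_lin a (- b) s oU fr fi Ux').
rewrite (partials_lin a b s oU fi fr Ux') /=.
by rewrite /GRing.scale/= !mul1r mulNr.
Qed.

Lemma partials0 s (x : V) : partials s (fun=> 0 : R) x = 0.
Proof.
suff -> : partials s (fun=> 0 : R) = cst 0 :> (V -> R) by [].
by elim: s => //= i s ->; apply/funext => y; rewrite /partial derive_cst.
Qed.

Lemma csmooth0 U : csmooth U (0 : V -> C).
Proof.
have r0 : rsmooth U (fun=> 0 : R).
  move=> s x _; suff -> : partials s (fun=> 0 : R) = cst 0 :> (V -> R) by [].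
  by apply/funext => y; rewrite partials0.
by split.
Qed.

Lemma cpartials0 s x : cpartials s (0 : V -> C) x = 0.
Proof. by rewrite /cpartials /= !partials0. Qed.

End Nets.

Section Colombeau.
Variables (R : realType) (d : nat).

Record openset := OpenSet {
  openset_set :> set 'rV[R]_d;
  openset_open : open openset_set }.

Definition fullspace := OpenSet (@openT 'rV[R]_d).

Lemma sub_fullspace (U : openset) : U `<=` fullspace.
Proof. exact: subsetT. Qed.

Lemma punctured_open : open [set x : 'rV[R]_d | x != 0].
Proof.
rewrite (_ : [set x | _] = ~` [set 0]).
  apply/closed_openC/accessible_closed_set1/hausdorff_accessible.
  exact: norm_hausdorff.
by apply/seteqP; split=> x /= /eqP.
Qed.

Definition punctured := OpenSet punctured_open.

Local Notation net := (R -> 'rV[R]_d -> R[i]^o).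
Implicit Types (U : openset) (u v : net).

Lemma sup_bigO_lin (A : set 'rV[R]_d) (g1 g2 g3 : R -> 'rV[R]_d -> R)
    (r1 r2 r3 : R -> R) (c : R) : 0 <= c ->
  (forall e, 0 < e -> 0 <= r1 e) -> (forall e, 0 < e -> 0 <= r2 e) ->
  (forall e, 0 < e -> 0 <= r3 e) ->
  (forall e, 0 < e <= 1 -> r1 e <= r3 e) ->
  (forall e, 0 < e <= 1 -> r2 e <= r3 e) ->
  (forall e x, 0 < e <= 1 -> A x -> g3 e x <= c * g1 e x + g2 e x) ->
  sup_bigO A g1 r1 -> sup_bigO A g2 r2 -> sup_bigO A g3 r3.
Proof.
move=> c0 r10 r20 r30 r13 r23 g123.
move=> /(sup_bigOP _ _ r10)[c1 c10 h1] /(sup_bigOP _ _ r20)[c2 c20 h2].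
apply/(sup_bigOP _ _ r30); exists (c * c1 + c2).
  by rewrite addr_ge0// mulr_ge0.
near=> e => x Ax.
have e01 : 0 < e <= 1.
  by apply/andP; split=> //; near: e; exact: nbhs_right_le.
apply: le_trans (g123 e x e01 Ax) _; rewrite mulrDl -mulrA lerD//.
  rewrite ler_wpM2l//; apply: (@le_trans _ _ (c1 * r1 e)); last first.
    by rewrite ler_wpM2l// r13.
  by move: x Ax; near: e.
apply: (@le_trans _ _ (c2 * r2 e)); last by rewrite ler_wpM2l// r23.
by move: x Ax; near: e.
Unshelve. all: by end_near. Qed.

Lemma sup_bigO0 (A : set 'rV[R]_d) (g : R -> 'rV[R]_d -> R) (r : R -> R) :
  (forall e x, g e x = 0) -> (forall e, 0 < e -> 0 <= r e) -> sup_bigO A g r.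
Proof.
move=> g0 r0; apply/(sup_bigOP _ _ r0); exists 0 => //.
by near=> e => x _; rewrite g0 mul0r.
Unshelve. all: by end_near. Qed.

Lemma expV_ge0 (N : nat) (e : R) : 0 < e -> 0 <= e ^- N.
Proof. by move=> e0; rewrite invr_ge0 exprn_ge0// ltW. Qed.

Lemma exp_pos_ge0 (m : nat) (e : R) : 0 < e -> 0 <= e ^+ m.
Proof. by move=> e0; rewrite exprn_ge0// ltW. Qed.

Lemma expV_le (M N : nat) (e : R) : (M <= N)%N -> 0 < e <= 1 -> e ^- M <= e ^- N.
Proof.
move=> MN /andP[e0 e1]; rewrite lef_pV2 ?posrE ?exprn_gt0//.
by rewrite ler_wiXn2l// ltW.
Qed.

Lemma enorm_ge0 (x : 'rV[R]_d) : 0 <= enorm x.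
Proof. exact: sqrtr_ge0. Qed.

Lemma weight_le (M N : nat) (x : 'rV[R]_d) : (M <= N)%N ->
  (1 + enorm x) ^- N <= (1 + enorm x) ^- M.
Proof.
have h : 1 <= 1 + enorm x by rewrite lerDl enorm_ge0.
move=> MN; rewrite lef_pV2 ?posrE ?exprn_gt0 ?(lt_le_trans ltr01 h)//.
exact: ler_weXn2l.
Qed.

Lemma weight_ge0 (N : nat) (x : 'rV[R]_d) : 0 <= (1 + enorm x) ^- N.
Proof. by rewrite invr_ge0 exprn_ge0// addr_ge0// enorm_ge0. Qed.

Lemma normc_ge0 (z : R[i]) : 0 <= normc z.
Proof. by case: z => a b; exact: sqrtr_ge0. Qed.

Lemma normc0' : normc (0 : R[i]) = 0.
Proof. exact: normc0. Qed.

Lemma mpartial_lin U (c : R[i]) u v beta e x : smooth_net U u -> smooth_net U v ->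
  0 < e <= 1 -> openset_set U x ->
  normc (mpartial beta ((c *: u + v) e) x) <=
  normc c * normc (mpartial beta (u e) x) + normc (mpartial beta (v e) x).
Proof.
move=> su sv e01 Ux.
rewrite [X in normc X <= _](_ : _ =
  c * mpartial beta (u e) x + mpartial beta (v e) x).
  by rewrite -normcM le_normcD.
exact: (cpartials_lin _ _ (@openset_open U) (su e e01) (sv e e01)).
Qed.

Lemma smooth_net_lin U (c : R[i]) u v : smooth_net U u -> smooth_net U v ->
  smooth_net U (c *: u + v).
Proof.
move=> su sv e e01.
exact: (csmooth_lin _ (@openset_open U) (su e e01) (sv e e01)).
Qed.

Lemma mpartial0 beta (x : 'rV[R]_d) : normc (mpartial beta (0 : _ -> R[i]^o) x) = 0.
Proof. by rewrite /mpartial cpartials0 normc0'. Qed.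

Lemma moderate0 U : moderate U 0.
Proof.
split=> [e _|L _ _ beta]; first exact: csmooth0.
exists 0%N; apply: sup_bigO0 => [e x|e e0]; last exact: expV_ge0.
exact: mpartial0.
Qed.

Lemma moderate_lin U (c : R[i]) u v :
  moderate U u -> moderate U v -> moderate U (c *: u + v).
Proof.
move=> [su hu] [sv hv]; split; first exact: smooth_net_lin.
move=> L cL LU beta.
have [N1 h1] := hu L cL LU beta; have [N2 h2] := hv L cL LU beta.
exists (maxn N1 N2); apply: (sup_bigO_lin (normc_ge0 c) _ _ _ _ _ _ h1 h2).
- by move=> *; exact: expV_ge0.
- by move=> *; exact: expV_ge0.
- by move=> *; exact: expV_ge0.
- by move=> *; apply: expV_le => //; rewrite leq_maxl.
- by move=> *; apply: expV_le => //; rewrite leq_maxr.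
- by move=> e x e01 Lx; apply: (mpartial_lin _ _ su sv) => //; exact: LU.
Qed.

Lemma negligible0 U : negligible_net U 0.
Proof.
move=> L _ _ beta m; apply: sup_bigO0 => [e x|e e0]; first exact: mpartial0.
exact: exp_pos_ge0.
Qed.

Lemma negligible_lin U (c : R[i]) u v : smooth_net U u -> smooth_net U v ->
  negligible_net U u -> negligible_net U v -> negligible_net U (c *: u + v).
Proof.
move=> su sv hu hv L cL LU beta m.
apply: (sup_bigO_lin (normc_ge0 c) _ _ _ _ _ _
  (hu L cL LU beta m) (hv L cL LU beta m)) => //.
- by move=> *; exact: exp_pos_ge0.
- by move=> *; exact: exp_pos_ge0.
- by move=> *; exact: exp_pos_ge0.
- by move=> e x e01 Lx; apply: (mpartial_lin _ _ su sv) => //; exact: LU.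
Qed.

Lemma moderate_tau0 U : moderate_tau U 0.
Proof.
split=> [e _|beta]; first exact: csmooth0.
exists 0%N; apply: sup_bigO0 => [e x|e e0]; last exact: expV_ge0.
by rewrite mpartial0 mulr0.
Qed.

Lemma weighted_lin U (c : R[i]) u v beta (N1 N2 N : nat) e x :
  smooth_net U u -> smooth_net U v -> (N1 <= N)%N -> (N2 <= N)%N ->
  0 < e <= 1 -> openset_set U x ->
  (1 + enorm x) ^- N * normc (mpartial beta ((c *: u + v) e) x) <=
  normc c * ((1 + enorm x) ^- N1 * normc (mpartial beta (u e) x)) +
  (1 + enorm x) ^- N2 * normc (mpartial beta (v e) x).
Proof.
move=> su sv N1N N2N e01 Ux.
apply: le_trans (ler_wpM2l (weight_ge0 N x)
  (mpartial_lin c beta su sv e01 Ux)) _.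
rewrite mulrDr mulrCA lerD//.
  rewrite ler_wpM2l ?normc_ge0// ler_wpM2r ?normc_ge0//; exact: weight_le.
by rewrite ler_wpM2r ?normc_ge0//; exact: weight_le.
Qed.

Lemma moderate_tau_lin U (c : R[i]) u v :
  moderate_tau U u -> moderate_tau U v -> moderate_tau U (c *: u + v).
Proof.
move=> [su hu] [sv hv]; split; first exact: smooth_net_lin.
move=> beta; have [N1 h1] := hu beta; have [N2 h2] := hv beta.
exists (maxn N1 N2); apply: (sup_bigO_lin (normc_ge0 c) _ _ _ _ _ _ h1 h2).
- by move=> *; exact: expV_ge0.
- by move=> *; exact: expV_ge0.
- by move=> *; exact: expV_ge0.
- by move=> *; apply: expV_le => //; rewrite leq_maxl.
- by move=> *; apply: expV_le => //; rewrite leq_maxr.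
- by move=> e x e01 Ux; apply: (weighted_lin _ _ su sv);
    rewrite ?leq_maxl ?leq_maxr.
Qed.

Lemma negligible_tau0 U : negligible_tau U 0.
Proof.
move=> beta; exists 0%N => p.
apply: sup_bigO0 => [e x|e e0]; first by rewrite mpartial0 mulr0.
exact: exp_pos_ge0.
Qed.

Lemma negligible_tau_lin U (c : R[i]) u v :
  smooth_net U u -> smooth_net U v ->
  negligible_tau U u -> negligible_tau U v -> negligible_tau U (c *: u + v).
Proof.
move=> su sv hu hv beta; have [N1 h1] := hu beta; have [N2 h2] := hv beta.
exists (maxn N1 N2) => p.
apply: (sup_bigO_lin (normc_ge0 c) _ _ _ _ _ _ (h1 p) (h2 p)) => //.
- by move=> *; exact: exp_pos_ge0.
- by move=> *; exact: exp_pos_ge0.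
- by move=> *; exact: exp_pos_ge0.
- by move=> e x e01 Ux; apply: (weighted_lin _ _ su sv);
    rewrite ?leq_maxl ?leq_maxr.
Qed.

End Colombeau.

Arguments sub_fullspace {R d} U _ _.

Section Algebras.
Variables (R : realType) (d : nat).
Local Notation net := (R -> 'rV[R]_d -> R[i]^o).
Implicit Types (U : openset R d).

Definition EM_pred U : {pred net} := fun u => `[< moderate U u >].

Lemma EM_pred_closed U : submod_closed (EM_pred U).
Proof.
split=> [|c u v /asboolP hu /asboolP hv]; apply/asboolP.
  exact: moderate0.
exact: moderate_lin.
Qed.

HB.instance Definition _ U :=
  GRing.isSubmodClosed.Build _ _ (EM_pred U) (EM_pred_closed U).

Record EMod U := MkEM { EM_net :> net; EM_netP : EM_net \in EM_pred U }.
HB.instance Definition _ U := [isSub for @EM_net U].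
HB.instance Definition _ U := [Choice of EMod U by <:].
HB.instance Definition _ U := [SubChoice_isSubLmodule of EMod U by <:].

Lemma EM_moderate U (u : EMod U) : moderate U u.
Proof. exact/asboolP/EM_netP. Qed.

Definition ideal_N U : {pred EMod U} := fun u => `[< negligible_net U u >].

Lemma ideal_N_closed U : submod_closed (@ideal_N U).
Proof.
split=> [|c u v /asboolP hu /asboolP hv]; apply/asboolP.
  exact: negligible0.
exact: (negligible_lin _ (proj1 (EM_moderate u)) (proj1 (EM_moderate v)) hu hv).
Qed.

HB.instance Definition _ U :=
  GRing.isSubmodClosed.Build _ _ (@ideal_N U) (@ideal_N_closed U).

Lemma ideal_N_scale U : scaler_closed (@ideal_N U).
Proof. by move=> c u uN; exact: rpredZ. Qed.

(* G(U) = E_M(U) / N(U), as a module over R[i]; E_M(U) and N(U) are subspaces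
   for the pointwise operations on nets. *)
Definition colombeau U : Type := lquot (@ideal_N_scale U).
HB.instance Definition _ U := GRing.Lmodule.on (colombeau U).
HB.instance Definition _ U := EqQuotient.on (colombeau U).

Definition EM_tau_pred U : {pred net} := fun u => `[< moderate_tau U u >].

Lemma EM_tau_pred_closed U : submod_closed (EM_tau_pred U).
Proof.
split=> [|c u v /asboolP hu /asboolP hv]; apply/asboolP.
  exact: moderate_tau0.
exact: moderate_tau_lin.
Qed.

HB.instance Definition _ U :=
  GRing.isSubmodClosed.Build _ _ (EM_tau_pred U) (EM_tau_pred_closed U).

Record EMod_tau U :=
  MkEM_tau { EM_tau_net :> net; EM_tau_netP : EM_tau_net \in EM_tau_pred U }.
HB.instance Definition _ U := [isSub for @EM_tau_net U].
HB.instance Definition _ U := [Choice of EMod_tau U by <:].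
HB.instance Definition _ U := [SubChoice_isSubLmodule of EMod_tau U by <:].

Lemma EM_tau_moderate U (u : EMod_tau U) : moderate_tau U u.
Proof. exact/asboolP/EM_tau_netP. Qed.

Definition ideal_N_tau U : {pred EMod_tau U} := fun u => `[< negligible_tau U u >].

Lemma ideal_N_tau_closed U : submod_closed (@ideal_N_tau U).
Proof.
split=> [|c u v /asboolP hu /asboolP hv]; apply/asboolP.
  exact: negligible_tau0.
exact: (negligible_tau_lin _ (proj1 (EM_tau_moderate u))
  (proj1 (EM_tau_moderate v)) hu hv).
Qed.

HB.instance Definition _ U :=
  GRing.isSubmodClosed.Build _ _ (@ideal_N_tau U) (@ideal_N_tau_closed U).

Lemma ideal_N_tau_scale U : scaler_closed (@ideal_N_tau U).
Proof. by move=> c u uN; exact: rpredZ. Qed.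

(* G_tau(U) = E_(M,tau)(U) / N_tau(U). *)
Definition tempered U : Type := lquot (@ideal_N_tau_scale U).
HB.instance Definition _ U := GRing.Lmodule.on (tempered U).
HB.instance Definition _ U := EqQuotient.on (tempered U).

End Algebras.

Section Maps.
Variables (R : realType) (d : nat).
Local Notation net := (R -> 'rV[R]_d -> R[i]^o).
Implicit Types (U V : openset R d).

Lemma colombeau_eqP U (u v : EMod U) :
  \pi_(colombeau U) u = \pi_(colombeau U) v <->
  negligible_net U (EM_net u - EM_net v).
Proof.
apply: (iff_trans (lquot_eqP _ _ _)).
by split=> [/asboolP|h]; [|apply/asboolP].
Qed.

Lemma tempered_eqP U (u v : EMod_tau U) :
  \pi_(tempered U) u = \pi_(tempered U) v <->
  negligible_tau U (EM_tau_net u - EM_tau_net v).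
Proof.
apply: (iff_trans (lquot_eqP _ _ _)).
by split=> [/asboolP|h]; [|apply/asboolP].
Qed.

Lemma smooth_net_sub U V (u : net) : V `<=` U -> smooth_net U u -> smooth_net V u.
Proof.
move=> VU su e e01; have [h1 h2] := su e e01.
by split=> s x /VU; [exact: h1|exact: h2].
Qed.

Lemma restrict_subproof U V (VU : V `<=` U) (u : EMod U) :
  EM_net u \in EM_pred V.
Proof.
have [su hu] := EM_moderate u; apply/asboolP; split.
  exact: smooth_net_sub su.
by move=> L cL LV; apply: hu => //; exact: subset_trans VU.
Qed.

Definition EM_restrict U V (VU : V `<=` U) (u : EMod U) : EMod V :=
  MkEM (restrict_subproof VU u).

Definition colombeau_restrict U V (VU : V `<=` U) (u : colombeau U) : colombeau V :=
  \pi_(colombeau V) (EM_restrict VU (repr u)).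

Lemma colombeau_restrict_pi U V (VU : V `<=` U) (u : EMod U) :
  colombeau_restrict VU (\pi_(colombeau U) u) = \pi_(colombeau V) (EM_restrict VU u).
Proof.
apply/colombeau_eqP => L cL LV; have LU := subset_trans LV VU.
have /colombeau_eqP : \pi_(colombeau U) (repr (\pi_(colombeau U) u)) = \pi_(colombeau U) u.
  by rewrite reprK.
by apply.
Qed.

Lemma coord_mx_norm_le (x : 'rV[R]_d) i : `|x 0 i| <= `|x|.
Proof. by rewrite [leRHS]mx_normrE; exact: (le_bigmax _ (fun ij => `|x ij.1 ij.2|) (0, i)). Qed.

Lemma enorm_bounded (L : set 'rV[R]_d) : compact L ->
  exists2 B : R, 0 <= B & forall x, L x -> 1 + enorm x <= B.
Proof.
move=> /compact_bounded [M [_ /(_ (M + 1))]]; rewrite ltrDl => /(_ ltr01) LM.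
exists (1 + Num.sqrt (\sum_(i < d) (M + 1) ^+ 2)).
  by rewrite addr_ge0// sqrtr_ge0.
move=> x Lx; rewrite lerD2l; apply: ler_wsqrtr; apply: ler_sum => i _.
have h : `|x 0 i| <= M + 1 by apply: le_trans (LM x Lx); exact: coord_mx_norm_le.
by rewrite -real_normK ?num_real// lerXn2r ?nnegrE// (le_trans _ h).
Qed.

Lemma tau_bigO U (L : set 'rV[R]_d) (g : R -> 'rV[R]_d -> R) N (r : R -> R) :
  (forall e, 0 < e -> 0 <= r e) -> (forall e x, 0 <= g e x) ->
  compact L -> L `<=` U ->
  sup_bigO U (fun e x => (1 + enorm x) ^- N * g e x) r -> sup_bigO L g r.
Proof.
move=> r0 g0 cL LU /(sup_bigOP _ _ r0)[c c0 hc].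
have [B B0 LB] := enorm_bounded cL.
apply/(sup_bigOP _ _ r0); exists (B ^+ N * c).
  by rewrite mulr_ge0// exprn_ge0.
apply: filterS hc => e he x Lx.
have w0 : 0 < 1 + enorm x by rewrite ltr_pwDl// enorm_ge0.
have w1 : 0 < (1 + enorm x) ^+ N by rewrite exprn_gt0.
have := he x (LU _ Lx); rewrite ler_pdivrMl// => /le_trans; apply.
rewrite -mulrA ler_wpM2r//.
  exact: le_trans (mulr_ge0 (weight_ge0 N x) (g0 e x)) (he x (LU _ Lx)).
by apply: lerXn2r; rewrite ?nnegrE ?(ltW w0)//; exact: LB.
Qed.

Lemma tau_subproof U (u : EMod_tau U) : EM_tau_net u \in EM_pred U.
Proof.
have [su hu] := EM_tau_moderate u; apply/asboolP; split=> // L cL LU beta.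
have [N hN] := hu beta; exists N; apply: tau_bigO hN => //.
  by move=> *; exact: expV_ge0.
by move=> *; exact: normc_ge0.
Qed.

Definition EM_of_tau U (u : EMod_tau U) : EMod U := MkEM (tau_subproof u).

Definition tempered_to_colombeau U (u : tempered U) : colombeau U :=
  \pi_(colombeau U) (EM_of_tau (repr u)).

Lemma tempered_to_colombeau_pi U (u : EMod_tau U) :
  tempered_to_colombeau (\pi_(tempered U) u) = \pi_(colombeau U) (EM_of_tau u).
Proof.
apply/colombeau_eqP => L cL LU beta m.
have /tempered_eqP/(_ beta)[N hN] :
    \pi_(tempered U) (repr (\pi_(tempered U) u)) = \pi_(tempered U) u.
  by rewrite reprK.
apply: tau_bigO (hN m) => //.
  by move=> *; exact: exp_pos_ge0.
by move=> *; exact: normc_ge0.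
Qed.

Lemma cpartials_dil U V (f : 'rV[R]_d -> R[i]^o) (l : R) s :
  (forall x : 'rV[R]_d, openset_set V x -> openset_set U (l *: x)) ->
  csmooth U f -> forall x, openset_set V x ->
  cpartials s (fun y => f (l *: y)) x =
  (l ^+ size s)%:C * cpartials s f (l *: x).
Proof.
move=> VU [fr fi] x Vx; rewrite /cpartials.
rewrite (partials_dil s (@openset_open _ _ V) VU fr (mem_set Vx)).
rewrite (partials_dil s (@openset_open _ _ V) VU fi (mem_set Vx)).
by rewrite /GRing.mul/= !mul0r subr0 addr0.
Qed.

Lemma normc_real (a : R) : normc (a%:C) = `|a|.
Proof. by rewrite /= expr0n/= addr0 sqrtr_sqr. Qed.

Lemma dil_bigO U V (u : net) (l : R) (L : set 'rV[R]_d) s (r : R -> R) :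
  (forall e, 0 < e -> 0 <= r e) ->
  (forall x : 'rV[R]_d, openset_set V x -> openset_set U (l *: x)) ->
  smooth_net U u -> L `<=` V ->
  sup_bigO [set l *: x | x in L] (fun e x => normc (cpartials s (u e) x)) r ->
  sup_bigO L (fun e x => normc (cpartials s (fun y => u e (l *: y)) x)) r.
Proof.
move=> r0 VU su LV /(sup_bigOP _ _ r0)[c c0 hc].
apply/(sup_bigOP _ _ r0); exists (`|l ^+ size s| * c); first exact: mulr_ge0.
near=> e => x Lx.
have e01 : 0 < e <= 1.
  by apply/andP; split=> //; near: e; exact: nbhs_right_le.
rewrite (cpartials_dil s VU (su e e01) (LV _ Lx)) normcM normc_real -mulrA.
rewrite ler_wpM2l//.
have Lx' : [set l *: y | y in L] (l *: x) by exists x.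
by move: (l *: x) Lx'; near: e.
Unshelve. all: by end_near. Qed.

Local Notation V0 := (punctured R d).

Lemma puncturedZ (l : {posnum R}) (x : 'rV[R]_d) :
  openset_set V0 x -> openset_set V0 (l%:num *: x).
Proof. by move=> /= x0; rewrite scaler_eq0 negb_or x0 andbT gt_eqF. Qed.

Lemma compact_dil (l : R) (L : set 'rV[R]_d) :
  compact L -> compact [set l *: x | x in L].
Proof.
move=> cL; apply: continuous_compact => //.
exact/continuous_subspaceT/scaler_continuous.
Qed.

Lemma punctured_dil (l : {posnum R}) (L : set 'rV[R]_d) :
  L `<=` V0 -> [set l%:num *: x | x in L] `<=` V0.
Proof. by move=> LV _ [x Lx <-]; exact/puncturedZ/LV. Qed.

Lemma dilate_subproof (l : {posnum R}) (u : EMod V0) :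
  (fun (e : R) (x : 'rV[R]_d) => EM_net u e (l%:num *: x)) \in EM_pred V0.
Proof.
have [su hu] := EM_moderate u; apply/asboolP; split.
  move=> e e01; have [ur ui] := su e e01.
  split; [move: ur|move: ui]; apply: rsmooth_dil; solve
    [exact: openset_open|exact: puncturedZ].
move=> L cL LV beta.
have [N hN] := hu _ (compact_dil (l := l%:num) cL) (punctured_dil LV) beta.
exists N; apply: (dil_bigO _ (@puncturedZ l) su LV hN) => *.
exact: expV_ge0.
Qed.

(* u(lambda x), for lambda > 0. *)
Definition EM_dilate (l : {posnum R}) (u : EMod V0) : EMod V0 :=
  MkEM (dilate_subproof l u).

Definition colombeau_dilate (l : {posnum R}) (u : colombeau V0) : colombeau V0 :=
  \pi_(colombeau V0) (EM_dilate l (repr u)).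

Lemma colombeau_dilate_pi (l : {posnum R}) (u : EMod V0) :
  colombeau_dilate l (\pi_(colombeau V0) u) = \pi_(colombeau V0) (EM_dilate l u).
Proof.
apply/colombeau_eqP => L cL LV beta m.
have /colombeau_eqP h :
    \pi_(colombeau V0) (repr (\pi_(colombeau V0) u)) = \pi_(colombeau V0) u.
  by rewrite reprK.
set w := EM_net _ - EM_net _ in h.
have sw : smooth_net V0 w.
  exact: (EM_moderate (repr (\pi_(colombeau V0) u) - u)).1.
apply: (dil_bigO _ (@puncturedZ l) sw LV) => [e|]; first exact: exp_pos_ge0.
exact: h (compact_dil cL) (punctured_dil LV) _ _.
Qed.

Lemma colombeau_scale_pi U (c : R[i]) (u : EMod U) :
  c *: (\pi_(colombeau U) u : colombeau U) = \pi_(colombeau U) (c *: u).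
Proof. exact: lquot_scale_pi. Qed.

End Maps.

(* Main.v *)
(* Homogeneity with respect to the two ratios 2 and 1/2 alone transports the
   moderateness estimate of a derivative of u on the annulus 1/2 <= |x| <= 2 to
   every larger annulus, at the price of a constant but with the same exponent
   of 1/e.  So for each derivative the exponent N does not depend on the compact
   set.  Multiply u_e by smooth cutoffs chi_k equal to 1 on the k-th annulus and
   supported in the next one.  By Leibniz' rule the derivatives of chi_k u_e are
   O(e^-N') on the whole space with N' independent of k.  Letting
   k = K(e) tend to infinity slowly enough makes v_e = chi_(K e) u_e tempered,
   and v_e = u_e near any given compact set for small e. *)

Require Import Defs.
From HB Require Import structures.
From mathcomp Require Import all_boot all_order all_algebra complex.
From mathcomp Require Import all_classical all_reals all_analysis.
From mathcomp Require Import ring lra.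

Import Order.TTheory GRing.Theory Num.Theory.
Import numFieldNormedType.Exports.

Local Open Scope classical_set_scope.
Local Open Scope ring_scope.
Local Open Scope complex_scope.

(** * Flat functions on the real line *)

Section Flat.
Set Implicit Arguments.
Unset Strict Implicit.
Variable R : realType.
Implicit Types (n : nat) (t : R).

(** The classical function [exp (- 1/t)], extended by 0, is the case [n = 0]. The other powers are
    added because differentiation produces them. *)
Definition flat n t : R := if 0 < t then t^-1 ^+ n * expR (- t^-1) else 0.

Lemma flat_ge0 n t : 0 <= flat n t.
Proof.
rewrite /flat; case: ifPn => // t0.
by rewrite mulr_ge0 ?expR_ge0// exprn_ge0// invr_ge0 ltW.
Qed.

Lemma flat_le0 n t : t <= 0 -> flat n t = 0.
Proof. by rewrite /flat ltNge => ->. Qed.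

Lemma flat_gt0 n t : 0 < t -> 0 < flat n t.
Proof. by move=> t0; rewrite /flat t0 mulr_gt0 ?expR_gt0// exprn_gt0// invr_gt0. Qed.

Lemma flat0_le : {homo flat 0 : s t / s <= t}.
Proof.
move=> s t st; have [s0|s0] := leP s 0; first by rewrite flat_le0// flat_ge0.
have t0 := lt_le_trans s0 st.
by rewrite /flat s0 t0 !expr0 !mul1r ler_expR lerN2 lef_pV2.
Qed.

Lemma flat_bound n t : flat n t <= n.+2`!%:R * t ^+ 2.
Proof.
rewrite /flat; case: ifPn => [t0|_]; last by rewrite mulr_ge0// sqr_ge0.
have y0 : 0 < t^-1 by rewrite invr_gt0.
rewrite expRN -[t in _ * t ^+ 2]invrK.
move: y0; move: (t^-1) => y y0.
have := expR_ge1Dxn n.+1 (ltW y0).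
have f0 : 0 < (n.+2)`!%:R :> R by rewrite ltr0n fact_gt0.
move=> /(le_trans _)-/(_ (y ^+ n.+2 / n.+2`!%:R)).
rewrite lerDr ler01 => /(_ isT) h.
rewrite ler_pdivrMr ?expR_gt0//.
apply: (@le_trans _ _ (n.+2`!%:R * y^-1 ^+ 2 * (y ^+ n.+2 / n.+2`!%:R))).
  rewrite le_eqVlt; apply/orP; left; apply/eqP.
  rewrite !exprS expr0; field.
  by rewrite !gt_eqF.
by rewrite ler_wpM2l// mulr_ge0// ?sqr_ge0// ltW.
Qed.

Lemma is_derive_flat n t :
  is_derive t 1 (flat n) (flat n.+2 t - n%:R * flat n.+1 t).
Proof.
have [t0|t0|<-] := ltgtP 0 t.
- apply: (@near_eq_is_derive R R^o R^o (fun s => s^-1 ^+ n * expR (- s^-1))).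
    near=> s; have s0 : 0 < s by near: s; exact: lt_nbhsr.
    by rewrite /flat s0.
  have tn0 : t != 0 by rewrite gt_eqF.
  have dv : is_derive t 1 (fun s : R => s^-1) (- t ^- 2).
    by have := @is_deriveV R id t 1 1 tn0 _; rewrite /GRing.scale/= mulr1; apply.
  have de := @is_derive1_comp R expR (fun s => - s^-1) t _ _
    (is_derive_expR _) (is_deriveN dv).
  have dX := @is_deriveX R R^o (fun s : R^o => s^-1) n t 1 _ dv.
  have -> : (fun s : R^o => s^-1 ^+ n * expR (- s^-1)) =
      (fun s : R^o => s^-1) ^+ n * (expR \o (fun s => - s^-1)).
    by apply/funext => s; rewrite !fctE.
  apply: is_derive_eq (is_deriveM dX de) _.
  rewrite /flat t0 /GRing.scale/= fctE -exprVn; move: t^-1 => y; move: (expR _) => E.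
  by case: n {dX} => [|n] /=; rewrite !exprS ?expr0; ring.
- rewrite !flat_le0 ?(ltW t0)// mulr0 subr0.
  apply: (@near_eq_is_derive R R^o R^o (cst 0)).
  near=> s; have s0 : s < 0 by near: s; exact: lt_nbhsl.
  by rewrite flat_le0// ltW.
rewrite !flat_le0 // mulr0 subr0.
(* At 0 the difference quotient is at most a constant times [|h|], by the quadratic bound. *)
have cv : h^-1 *: ((flat n \o shift 0) (h *: 1) - flat n 0) @[h --> (0:R)^'] --> (0:R).
  apply/norm_cvg0P.
  have z : (n.+2)`!%:R * `|h| @[h --> (0:R)^'] --> (0:R).
    rewrite -[X in _ --> X](mulr0 (n.+2)`!%:R); apply: cvgMl_tmp.
    by apply/norm_cvg0P; exact: nbhs_dnbhs.
  apply: (squeeze_cvgr _ (cvg_cst 0) z); near=> h.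
  have h0 : h != 0 by near: h; exact: nbhs_dnbhs_neq.
  rewrite /= normr_ge0/= (flat_le0 n (lexx 0)) subr0 addr0.
  rewrite /GRing.scale/= mulr1 normrM normfV (ger0_norm (flat_ge0 _ _)).
  rewrite ler_pdivrMl ?normr_gt0// mulrCA -expr2 real_normK ?num_real//.
  exact: flat_bound.
by apply: DeriveDef; [apply/cvg_ex; exists 0|exact: cvg_lim cv].
Unshelve. all: by end_near. Qed.
End Flat.

(** * Stability of smooth functions under sums, products and flat functions *)

Section Smooth.
Set Implicit Arguments.
Unset Strict Implicit.
Variables (R : realType) (d : nat).
Local Notation V := 'rV[R]_d.
Implicit Types (U : set V) (f g : V -> R) (s : seq 'I_d) (i : 'I_d).

Lemma partials_rcons s i f : partials (rcons s i) f = partials s (partial i f).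
Proof. by rewrite /partials foldr_rcons. Qed.

Lemma rsmooth_partial U f i : rsmooth U f -> rsmooth U (partial i f).
Proof. by move=> sf s x Ux; rewrite -partials_rcons; exact: sf. Qed.

Lemma rsmooth_differentiable U f x : rsmooth U f -> U x -> differentiable f x.
Proof. by move=> sf; exact: (sf [::]). Qed.

Lemma eq_rsmooth U f g : open U -> {in U, f =1 g} -> rsmooth U f -> rsmooth U g.
Proof.
move=> oU fg sf s x Ux.
apply: (@near_eq_differentiable _ _ _ (partials s f)); last exact: sf.
have := open_nbhs_nbhs (conj oU Ux); apply: filterS => y Uy.
by rewrite (partials_eq s oU fg)// inE.
Qed.

(* [partials] differentiates in the direction [head s] last, so that a class
   closed under partial derivatives only up to equality on [U] still consists of
   smooth functions. *)
Lemma rsmooth_closed U (F : (V -> R) -> Prop) : open U ->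
  (forall f x, F f -> U x -> differentiable f x) ->
  (forall f i, F f -> exists2 g, F g & {in U, partial i f =1 g}) ->
  forall f, F f -> rsmooth U f.
Proof.
move=> oU dF pF f Ff s; elim/last_ind: s f Ff => [|s i IH] f Ff x Ux.
  exact: dF.
have [g Fg fg] := pF f i Ff; rewrite partials_rcons.
have gf : {in U, g =1 partial i f} by move=> y Uy; rewrite fg.
apply: (@near_eq_differentiable _ _ _ (partials s g)); last exact: IH.
have := open_nbhs_nbhs (conj oU Ux); apply: filterS => y Uy.
by rewrite (partials_eq s oU gf)// inE.
Qed.

Lemma partialM f g i x : differentiable f x -> differentiable g x ->
  partial i (fun y => f y * g y) x = f x * partial i g x + partial i f x * g x.
Proof.
move=> df dg; have -> : (fun y => f y * g y) = f * g by [].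
rewrite /partial deriveM; [|exact: diff_derivable..].
by rewrite /GRing.scale/= [g x * _]mulrC.
Qed.

Lemma partial_comp (h : R -> R) (h' : R) f i x : differentiable f x ->
  is_derive (f x) 1 h h' -> partial i (fun y => h (f y)) x = h' * partial i f x.
Proof.
move=> df [dh hE]; have /derivable1_diffP dh' := dh.
have -> : (fun y => h (f y)) = h \o f by [].
rewrite /partial (deriveE _ df) deriveE; last exact: differentiable_comp.
by rewrite diff_comp// diff1E//= derive1E hE mulrC.
Qed.

(** A class containing, up to equality on [U], the partial derivatives of its members. One induction
    then yields smoothness of sums, products and compositions at once, without a Leibniz or chain
    rule of higher order. All [flat n] are included since differentiating [flat n] gives [flat n.+1]
    and [flat n.+2]. *)
Inductive generated U : (V -> R) -> Prop :=
| gen_smooth f of rsmooth U f : generated U f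
| gen_add f g of generated U f & generated U g : generated U (fun x => f x + g x)
| gen_mul f g of generated U f & generated U g : generated U (fun x => f x * g x)
| gen_flat n f of generated U f : generated U (fun x => flat n (f x)).

Lemma generated_differentiable U f x : generated U f -> U x -> differentiable f x.
Proof.
move=> gf Ux; elim: gf => {f} [f sf|f g _ df _ dg|f g _ df _ dg|n f _ df].
- exact: rsmooth_differentiable sf Ux.
- exact: differentiableD.
- exact: differentiableM.
- apply: (@differentiable_comp _ _ _ _ f (flat n)) => //.
  by apply/derivable1_diffP; have [] := is_derive_flat n (f x).
Qed.

Lemma partials_cst s (c : R) : partials s (fun=> c : R) =
  (fun=> if s is [::] then c else 0) :> (V -> R).
Proof.
elim: s => [//|i s /= ->]; apply/funext => x; rewrite /partial.
exact: derive_cst.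
Qed.

Lemma rsmooth_cst U (c : R) : rsmooth U (fun=> c).
Proof. by move=> s x _; rewrite partials_cst. Qed.

Lemma generated_smooth U f : open U -> generated U f -> rsmooth U f.
Proof.
move=> oU; apply: (rsmooth_closed oU) => {f} [f x|f i gf].
  exact: generated_differentiable.
elim: gf => {f} [f sf|f g gf [f' gf' ff'] gg [g' gg' gg'E]|
    f g gf [f' gf' ff'] gg [g' gg' gg'E]|n f gf [f' gf' ff']].
- by exists (partial i f) => //; exact/gen_smooth/rsmooth_partial.
- exists (fun x => f' x + g' x); first exact: gen_add.
  move=> x Ux; rewrite -ff'// -gg'E// /partial.
  have := set_mem Ux => {}Ux.
  have -> : (fun y => f y + g y) = f + g by [].
  by rewrite deriveD//; apply: diff_derivable; exact: generated_differentiable Ux.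
- exists (fun x => f x * g' x + f' x * g x).
    by apply: gen_add; exact: gen_mul.
  move=> x Ux; rewrite -ff'// -gg'E//; have := set_mem Ux => {}Ux.
  by rewrite partialM//; exact: generated_differentiable Ux.
- exists (fun x => (flat n.+2 (f x) + - n%:R * flat n.+1 (f x)) * f' x).
    apply: gen_mul => //; apply: gen_add; first exact: gen_flat.
    by apply: gen_mul; [exact/gen_smooth/rsmooth_cst|exact: gen_flat].
  move=> x Ux; rewrite -ff'// mulNr; apply: partial_comp (is_derive_flat _ _).
  exact: generated_differentiable (set_mem Ux).
Qed.

Lemma rsmoothD U f g : open U ->
  rsmooth U f -> rsmooth U g -> rsmooth U (fun x => f x + g x).
Proof.
by move=> oU sf sg; apply: generated_smooth => //; apply: gen_add; exact: gen_smooth.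
Qed.

Lemma rsmoothM U f g : open U ->
  rsmooth U f -> rsmooth U g -> rsmooth U (fun x => f x * g x).
Proof.
by move=> oU sf sg; apply: generated_smooth => //; apply: gen_mul; exact: gen_smooth.
Qed.

Lemma rsmooth_flat U n f : open U ->
  rsmooth U f -> rsmooth U (fun x => flat n (f x)).
Proof. by move=> oU sf; apply: generated_smooth => //; apply/gen_flat/gen_smooth. Qed.

Lemma rsmooth_coord U j : open U -> rsmooth U (fun x : V => x 0 j).
Proof.
move=> oU.
(* The coordinate together with the constants is already a class stable under partial
   derivatives. *)
apply: (@rsmooth_closed U
  (fun f => f = (fun x => x 0 j) \/ exists c, f = fun=> c)) => //; last by left.
- by move=> f x [->|[c ->]] _; [exact: differentiable_coord|exact: differentiable_cst].
- move=> f i [->|[c ->]]; last first.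
    exists (fun=> 0); first by right; exists 0.
    by move=> x _; rewrite /partial derive_cst.
  exists (fun=> ('e_i : V) 0 j); first by right; eexists.
  move=> x _; rewrite /partial deriveE; last exact: differentiable_coord.
  have lin : linear (fun y : V => y 0 j : R^o) by move=> a y z; rewrite !mxE.
  pose linM := GRing.isLinear.Build _ _ _ _ _ lin.
  pose c : {linear V -> R^o} := HB.pack (fun y : V => y 0 j : R^o) linM.
  by rewrite (@diff_lin _ _ _ c)//; exact: coord_continuous.
Qed.

(** The square of the Euclidean norm: a polynomial, hence smooth at the origin too. *)
Definition sqnorm (x : V) : R := \sum_(i < d) x 0 i ^+ 2.

Lemma rsmooth_sqnorm U : open U -> rsmooth U sqnorm.
Proof.
move=> oU; rewrite (_ : sqnorm = \sum_(i < d) (fun x : V => x 0 i * x 0 i)); last first.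
  by apply/funext => x; rewrite fct_sumE; apply: eq_bigr => i _; rewrite expr2.
elim/big_ind: _ => [|f g sf sg|i _]; first exact: rsmooth_cst.
  exact: rsmoothD.
by apply: rsmoothM => //; exact: rsmooth_coord.
Qed.

Lemma rsmooth_continuous U f x : rsmooth U f -> U x -> {for x, continuous f}.
Proof.
by move=> sf Ux; exact/differentiable_continuous/(rsmooth_differentiable sf Ux).
Qed.

Lemma rsmooth_bounded U f (L : set V) : rsmooth U f -> compact L -> L `<=` U ->
  exists2 M : R, 0 <= M & forall x, L x -> `|f x| <= M.
Proof.
move=> sf cL LU.
have : compact (f @` L).
  apply: continuous_compact => //; apply: continuous_in_subspaceT => x.
  by rewrite inE => /LU; exact: rsmooth_continuous.
move=> /compact_bounded[M [_ /(_ (`|M| + 1))]].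
rewrite (le_lt_trans (ler_norm M)) ?ltrDl// => /(_ isT) h.
by exists (`|M| + 1); [rewrite addr_ge0|move=> x Lx; apply: h; exists x].
Qed.

Lemma partials_zero U f s x : open U -> (forall y, U y -> f y = 0) -> U x ->
  partials s f x = 0.
Proof.
move=> oU f0 Ux; have -> : partials s f x = partials s (fun=> 0) x.
  by apply: (partials_eq s oU); rewrite ?inE// => y; rewrite inE => /f0.
by rewrite partials_cst; case: s.
Qed.

End Smooth.

(** * Annuli and smooth cutoffs *)

Section Cutoff.
Set Implicit Arguments.
Unset Strict Implicit.
Variables (R : realType) (d : nat).
Local Notation V := 'rV[R]_d.
Implicit Types (x : V) (L : set V) (k : nat).

(* As [flat 0] is nondecreasing, the inner difference is nonpositive as soon as
   [1 <= t]: this avoids dividing by a function. *)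
Definition smooth_step (t : R) : R :=
  1 - flat 0 (flat 0 1 - flat 0 t) / flat 0 (flat 0 (1 : R)).

Lemma smooth_step0 t : t <= 0 -> smooth_step t = 0.
Proof.
move=> t0; rewrite /smooth_step (flat_le0 0 t0) subr0 divff ?subrr//.
by rewrite gt_eqF// !flat_gt0.
Qed.

Lemma smooth_step1 t : 1 <= t -> smooth_step t = 1.
Proof.
move=> t1; rewrite /smooth_step (@flat_le0 _ 0 (_ - _)) ?mul0r ?subr0//.
by rewrite subr_le0 flat0_le.
Qed.

Lemma rsmooth_step (U : set V) f : open U -> rsmooth U f ->
  rsmooth U (fun x => smooth_step (f x)).
Proof.
move=> oU sf; rewrite /smooth_step.
apply: rsmoothD => //; first exact: rsmooth_cst.
under eq_fun do rewrite -mulNr -mulN1r.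
apply: rsmoothM => //; last exact: rsmooth_cst.
apply: rsmoothM => //; first exact: rsmooth_cst.
apply: rsmooth_flat => //; apply: rsmoothD => //; first exact: rsmooth_cst.
under eq_fun do rewrite -mulN1r.
apply: rsmoothM => //; first exact: rsmooth_cst.
exact: rsmooth_flat.
Qed.

Lemma sqnorm_continuous : continuous (@sqnorm R d).
Proof. by move=> x; apply: (rsmooth_continuous (rsmooth_sqnorm openT)). Qed.

Lemma sqnormZ (l : R) x : sqnorm (l *: x) = l ^+ 2 * sqnorm x.
Proof. by rewrite /sqnorm mulr_sumr; apply: eq_bigr => i _; rewrite mxE exprMn. Qed.

Lemma coord_sqnorm x i : x 0 i ^+ 2 <= sqnorm x.
Proof. by rewrite /sqnorm (bigD1 i)//= lerDl sumr_ge0// => j _; rewrite sqr_ge0. Qed.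

Lemma sqnorm_gt0 x : (0 < sqnorm x) = (x != 0).
Proof.
have [->|x0] := eqVneq x 0.
  by rewrite /sqnorm big1 ?ltxx// => i _; rewrite mxE expr0n.
have [i xi] : exists i, x 0 i != 0.
  apply/existsP; apply: contraNT x0 => /existsPn xi.
  by apply/eqP/rowP => i; rewrite mxE; exact/eqP/negPn/xi.
apply: lt_le_trans (coord_sqnorm x i).
by rewrite lt_neqAle sqr_ge0 eq_sym sqrf_eq0 xi.
Qed.

(** Powers of 4 bound the squared norm, so this is [2 ^- k <= |x| <= 2 ^+ k]. The open version
    [shell] serves where derivatives require a neighbourhood. *)
Definition annulus k : set V := [set x | 4 ^- k <= sqnorm x <= 4 ^+ k].
Definition shell k : set V := [set x | 4 ^- k < sqnorm x < 4 ^+ k].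

Lemma shell_open k : open (shell k).
Proof.
rewrite (_ : shell k = sqnorm (d:=d) @^-1` `](4 ^- k : R), (4 ^+ k)[%classic).
  by apply: open_comp; [move=> x _; exact: sqnorm_continuous|exact: interval_open].
by apply/seteqP; split=> x; rewrite /shell /= in_itv.
Qed.

Lemma annulus_closed k : closed (annulus k).
Proof.
rewrite (_ : annulus k = sqnorm (d:=d) @^-1` `[(4 ^- k : R), (4 ^+ k)]%classic).
  by apply: preimage_closed;
    [move=> x _; exact: sqnorm_continuous|exact: interval_closed].
by apply/seteqP; split=> x; rewrite /annulus /= in_itv.
Qed.

Lemma annulus_compact k : compact (annulus k).
Proof.
apply: bounded_closed_compact; last exact: annulus_closed.
exists (4 ^+ k + 1); split; first exact: num_real.
move=> M kM x /andP[_ xk]; rewrite /= [leLHS]mx_normrE.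
apply: bigmax_le => [|[i j] _ /=].
  by rewrite (le_trans _ (ltW kM))// addr_ge0// exprn_ge0.
apply: le_trans (ltW kM).
rewrite (ord1 i).
have := le_trans (coord_sqnorm x j) xk; rewrite -(@real_normK _ (x 0 j)) ?num_real//.
have : 1 <= (4:R) ^+ k by rewrite exprn_ege1// ler1n.
move: (4 ^+ k) `|x 0 j| => a b; nra.
Qed.

Lemma annulus_punctured k : annulus k `<=` punctured R d.
Proof.
move=> x /andP[xk _] /=; rewrite -sqnorm_gt0; apply: lt_le_trans xk.
by rewrite invr_gt0 exprn_gt0.
Qed.

Lemma shell_annulus k l : (k <= l)%N -> shell k `<=` annulus l.
Proof.
move=> kl x /andP[kx xk]; apply/andP; split.
  by apply: le_trans (ltW kx); rewrite lef_pV2 ?posrE ?exprn_gt0// ler_weXn2l// ler1n.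
by apply: (le_trans (ltW xk)); rewrite ler_weXn2l// ler1n.
Qed.

Lemma annulus_shell k : annulus k `<=` shell k.+1.
Proof.
move=> x /andP[kx xk]; apply/andP; split.
  by apply: lt_le_trans kx; rewrite ltf_pV2 ?posrE ?exprn_gt0// ltr_eXn2l// ltr1n.
by apply: (le_lt_trans xk); rewrite ltr_eXn2l// ltr1n.
Qed.

(** Halve [x] if [|x| >= 1] and double it otherwise. For [k = 0] the annulus is only the unit
    sphere, whence the condition on [k]. *)
Lemma annulusS k x : (0 < k)%N -> annulus k.+1 x ->
  annulus k (2^-1 *: x) \/ annulus k (2 *: x).
Proof.
move=> k0 /andP[kx xk].
have k4 : 4 <= (4:R) ^+ k by rewrite -{1}(expr1 4) ler_weXn2l// ler1n.
have k4V : 4 ^- k <= (4:R)^-1 by rewrite lef_pV2 ?posrE ?exprn_gt0.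
move: kx xk; rewrite /annulus /= !sqnormZ exprS invfM.
move: k4 k4V; move: (sqnorm x) => q; move: (4 ^- k) => b.
move: (4 ^+ k) => a a4 b4 bq qa.
have [q1|q1] := leP 1 q; [left|right]; apply/andP; split; lra.
Qed.

(** Both [sqnorm] and its inverse are continuous on [L], hence bounded there. *)
Lemma compact_annulus L : compact L -> L `<=` punctured R d ->
  exists k, L `<=` annulus k.
Proof.
move=> cL LU.
have [M M0 LM] := rsmooth_bounded (rsmooth_sqnorm openT) cL (@subsetT _ _).
have : compact ((fun x => (sqnorm x)^-1) @` L).
  apply: continuous_compact => //; apply: continuous_in_subspaceT => x.
  rewrite inE => /LU /= x0; apply: continuousV; last exact: sqnorm_continuous.
  by rewrite gt_eqF// sqnorm_gt0.
move=> /compact_bounded[M' [_ /(_ (`|M'| + 1))]].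
rewrite (le_lt_trans (ler_norm M')) ?ltrDl// => /(_ isT) LM'.
have le4 (a : R) : 0 <= a -> a <= 4 ^+ (Num.truncn a).+1.
  move=> a0; apply: (le_trans (ltW (truncnS_gt a))).
  by rewrite -natrX ler_nat ltnW// ltn_expl.
(* A single exponent dominating the bounds of [sqnorm] and of its inverse. *)
pose k := (Num.truncn (M + `|M'| + 1)).+1.
have hk : M + `|M'| + 1 <= 4 ^+ k by apply: le4; rewrite !addr_ge0.
exists k => x Lx; have q0 : 0 < sqnorm x by rewrite sqnorm_gt0; exact: LU.
apply/andP; split; last first.
  apply: le_trans hk; apply: le_trans (ler_norm _) _; apply: le_trans (LM _ Lx) _.
  by rewrite -addrA lerDl addr_ge0.
rewrite -[leRHS]invrK lef_pV2 ?posrE ?invr_gt0// ?exprn_gt0//.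
apply: le_trans hk; apply: le_trans (ler_norm _) _.
apply: (le_trans (LM' _ _)); first by exists x.
by rewrite -addrA lerDr.
Qed.

(** The first factor vanishes for [|x| <= 2 ^- k.+1] and the second for [|x| >= 2 ^+ k.+1]; both
    equal 1 on [annulus k]. *)
Definition cutoff k x : R :=
  smooth_step (4 ^+ k.+1 * sqnorm x - 1) * smooth_step (4 ^+ k.+1 - sqnorm x).

Lemma rsmooth_cutoff k (U : set V) : open U -> rsmooth U (cutoff k).
Proof.
move=> oU; apply: rsmoothM => //; apply: rsmooth_step => //; apply: rsmoothD => //.
- apply: rsmoothM => //; [exact: rsmooth_cst|exact: rsmooth_sqnorm].
- exact: rsmooth_cst.
- exact: rsmooth_cst.
under eq_fun do rewrite -mulN1r.
apply: rsmoothM => //; [exact: rsmooth_cst|exact: rsmooth_sqnorm].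
Qed.

Lemma cutoff1 k x : annulus k x -> cutoff k x = 1.
Proof.
move=> /andP[kx xk].
have k4 : 1 <= (4:R) ^+ k by rewrite exprn_ege1// ler1n.
have {kx} : 1 <= sqnorm x * 4 ^+ k by rewrite -ler_pdivrMr ?exprn_gt0// mul1r.
rewrite /cutoff exprS; move: k4 xk; move: (4 ^+ k) (sqnorm x) => a q a1 qa aq.
by rewrite !smooth_step1 ?mulr1//; lra.
Qed.

Lemma cutoff0 k x : ~ annulus k.+1 x -> cutoff k x = 0.
Proof.
move=> /negP; rewrite negb_and -!ltNge => /orP[kx|xk]; rewrite /cutoff.
  rewrite [X in X * _]smooth_step0 ?mul0r// subr_le0 mulrC.
  by rewrite -ler_pdivlMr ?exprn_gt0// mul1r ltW.
by rewrite [X in _ * X]smooth_step0 ?mulr0// subr_le0 ltW.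
Qed.

End Cutoff.

(** * Orders of growth as [e] tends to 0 *)

Section Orders.
Set Implicit Arguments.
Unset Strict Implicit.
Variable R : realType.

Lemma near_unit_interval : \forall e \near (0:R)^'+, 0 < e <= 1.
Proof.
by near=> e; apply/andP; split=> //; near: e; exact: nbhs_right_le.
Unshelve. all: by end_near. Qed.

(** One more power of [1/e] replaces any constant. Constants depending on the compact set or on the
    cutoff thus affect only how small [e] must be, not the exponent. *)
Lemma near_absorb (c : R) N : \forall e \near (0:R)^'+, c * e ^- N <= e ^- N.+1.
Proof.
near=> e.
have e0 : 0 < e by [].
rewrite exprS invfM ler_wpM2r ?invr_ge0 ?exprn_ge0 ?(ltW e0)//.
apply: (le_trans (ler_norm c)); apply: (@le_trans _ _ (`|c| + 1)).
  by rewrite lerDl.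
rewrite -[leLHS]invrK lef_pV2 ?posrE// ?invr_gt0 ?ltr_pwDr//.
near: e; apply: nbhs_right_le; by rewrite invr_gt0 ltr_pwDr.
Unshelve. all: by end_near. Qed.

(** Diagonal argument: [K e] is the largest [k <= 1/e] for which [P k e] holds. Each fixed [k] is
    admissible for small [e], so [K e] tends to infinity. *)
Lemma slow_index (P : nat -> R -> Prop) :
  (forall k, \forall e \near 0^'+, P k e) ->
  exists K : R -> nat, (\forall e \near 0^'+, P (K e) e) /\
    forall k, \forall e \near 0^'+, (k <= K e)%N.
Proof.
move=> hP.
pose K (e : R) := (\max_(k < (Num.truncn e^-1).+1 | `[< P k e >]) k)%N.
have kK k : \forall e \near 0^'+, (k <= K e)%N.
  have k0 : 0 < k.+1%:R^-1 :> R by rewrite invr_gt0.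
  near=> e.
  have ke : (k < (Num.truncn e^-1).+1)%N.
    rewrite ltnS truncn_ge_nat ?invr_ge0//.
    apply: (@le_trans _ _ k.+1%:R); first by rewrite ler_nat.
    rewrite -[leLHS]invrK lef_pV2 ?posrE//.
    by near: e; exact: nbhs_right_le.
  apply: (@leq_bigmax_cond _ _ (fun i : 'I__ => i : nat) (Ordinal ke)).
  by apply/asboolP => /=; near: e; exact: hP.
exists K; split=> //; near=> e.
(* The index 0 is admissible for small [e], so the maximum is taken over a nonempty set and is
   attained; over an empty set it would default to 0. *)
have P0 : `[< P (ord0 : 'I_(Num.truncn e^-1).+1) e >].
  by apply/asboolP; near: e; exact: hP.
have [|k /asboolP Pk Kk] := @eq_bigmax_cond _
    (fun k : 'I_(Num.truncn e^-1).+1 => `[< P k e >]) (fun k => k : nat).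
  by apply/card_gt0P; exists ord0.
by rewrite /K Kk.
Unshelve. all: by end_near. Qed.

Lemma near_forall_leq (P : nat -> R -> Prop) k :
  (forall j, \forall e \near 0^'+, P j e) ->
  \forall e \near 0^'+, forall j, (j <= k)%N -> P j e.
Proof.
move=> hP; elim: k => [|k IH].
  by apply: filterS (hP 0%N) => e P0 j; rewrite leqn0 => /eqP ->.
apply: filterS2 IH (hP k.+1) => e Pk Pk1 j; rewrite leq_eqVlt ltnS => /orP[/eqP->//|].
exact: Pk.
Qed.

End Orders.

(** * Sublists of multi-indices *)

Section Directions.
Variable d : nat.

(* The derivatives in Leibniz' rule for [mpartial] are along sublists of
   [directions beta], hence again of this form: the symmetry of second
   derivatives is not needed. *)
Lemma subseq_directions (s : seq 'I_d) (beta : 'I_d -> nat) :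
  subseq s (directions beta) -> exists beta', s = directions beta'.
Proof.
rewrite /directions; have := enum_uniq 'I_d; move: (enum 'I_d) => l.
elim: l s => [|i l IH] s.
  by move=> _; rewrite subseq0 => /eqP ->; exists beta.
rewrite cons_uniq => /andP[il ul] /subseqP[m]; rewrite /= size_cat => sm ->.
rewrite -[m](cat_take_drop (size (nseq (beta i) i))) mask_cat; last first.
  by rewrite size_takel// sm leq_addr.
set s1 := mask _ _; set s2 := mask _ _.
have [|b s2E] := IH s2 ul; first exact: mask_subseq.
have s1E : s1 = nseq (size s1) i.
  by apply/all_pred1P/allP => j /mem_mask; rewrite mem_nseq => /andP[_ /eqP ->] /=.
exists (fun j => if j == i then size s1 else b j); rewrite eqxx -s1E s2E.
congr (_ ++ flatten _); apply/eq_in_map => j jl.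
by case: eqP jl il => // -> ->.
Qed.

End Directions.

(** * Growth of products with a fixed smooth function *)

Section Products.
Set Implicit Arguments.
Unset Strict Implicit.
Variables (R : realType) (d : nat).
Local Notation V := 'rV[R]_d.
Implicit Types (U L : set V) (s : seq 'I_d) (w : R -> V -> R).

(** The exponent is chosen before the compact set, and no constant appears. *)
Definition uniform_order U s w := exists N : nat, forall L, compact L -> L `<=` U ->
  \forall e \near 0^'+, forall x, L x -> `|partials s (w e) x| <= e ^- N.

(** Leibniz' rule by induction on [s], peeling off the innermost derivative. The exponent precedes
    [chi] and [L]: derivatives of [chi] are bounded on [L], and their bounds are absorbed in a power
    of [1/e]. *)
Lemma uniform_orderM U s w : open U ->
  (forall e, 0 < e <= 1 -> rsmooth U (w e)) ->
  (forall s', subseq s' s -> uniform_order U s' w) ->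
  exists N : nat, forall chi, rsmooth U chi -> forall L, compact L -> L `<=` U ->
  \forall e \near 0^'+, forall x, L x ->
    `|partials s (fun y => chi y * w e y) x| <= e ^- N.
Proof.
move=> oU; elim/last_ind: s w => [|s i IH] w sw hw.
  have [N hN] := hw [::] (subseq_refl _).
  exists N.+1 => chi schi L cL LU.
  have [M M0 LM] := rsmooth_bounded schi cL LU.
  near=> e => x Lx; rewrite /= normrM.
  apply: (@le_trans _ _ (M * e ^- N)).
    apply: ler_pM => //; first exact: LM.
    by move: x Lx; near: e; exact: hN.
  by near: e; exact: near_absorb.
(* The term where [w] is differentiated: derivatives of [partial i w] along [s'] are those of [w]
   along [rcons s' i]. *)
have [|N1 h1] := IH (fun e => partial i (w e))
    (fun e e01 => rsmooth_partial i (sw e e01)).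
  move=> s' ss'; have [|N hN] := hw (rcons s' i); first by rewrite -!cats1 cat_subseq.
  exists N => L cL LU; have := hN L cL LU; apply: filterS => e he x Lx.
  by rewrite -partials_rcons; exact: he.
(* The term where [chi] is differentiated: [partial i chi] takes the place of [chi], which the
   induction hypothesis quantifies universally. *)
have [|N2 h2] := IH w sw.
  move=> s' ss'; apply: hw; exact: subseq_trans ss' (subseq_rcons _ _).
exists (maxn N1 N2).+1 => chi schi L cL LU.
near=> e => x Lx.
have e01 : 0 < e <= 1 by near: e; exact: near_unit_interval.
have Ux := LU _ Lx.
have swe := sw e e01.
pose f1 := fun y => chi y * partial i (w e) y.
pose f2 := fun y => partial i chi y * w e y.
have -> : partials (rcons s i) (fun y => chi y * w e y) x =
    partials s f1 x + partials s f2 x.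
  rewrite partials_rcons.
  have sf1 : rsmooth U f1 by apply: rsmoothM => //; exact: rsmooth_partial.
  have sf2 : rsmooth U f2 by apply: rsmoothM => //; exact: rsmooth_partial.
  have := partials_lin 1 1 s oU sf1 sf2 (mem_set Ux).
  rewrite /= {1 2}/GRing.scale/= !mul1r => <-.
  apply: (partials_eq s oU); last exact: mem_set.
  move=> y /set_mem Uy /=; rewrite partialM/=; last 2 first.
    exact: rsmooth_differentiable schi Uy.
    exact: rsmooth_differentiable swe Uy.
  by rewrite /GRing.scale/= !mul1r.
apply: (le_trans (ler_normD _ _)).
apply: (@le_trans _ _ (2 * e ^- (maxn N1 N2))); last by near: e; exact: near_absorb.
rewrite mulr_natl mulr2n lerD//.
  apply: (@le_trans _ _ (e ^- N1)); last by rewrite expV_le// leq_maxl.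
  by rewrite /f1; move: x Lx {Ux}; near: e; exact: h1 chi schi L cL LU.
apply: (@le_trans _ _ (e ^- N2)); last by rewrite expV_le// leq_maxr.
by rewrite /f2; move: x Lx {Ux}; near: e; exact: h2 _ (rsmooth_partial i schi) L cL LU.
Unshelve. all: by end_near. Qed.

End Products.

(** * Uniform growth of homogeneous classes and tempered extension *)

Section Extension.
Set Implicit Arguments.
Unset Strict Implicit.
Import ComplexField.Normc.
Local Open Scope quotient_scope.
Variables (R : realType) (d : nat).
Local Notation V := 'rV[R]_d.
Local Notation U := (punctured R d).
Implicit Types (L : set V) (s : seq 'I_d) (u : EMod U).

(** Differentiating [u (l x) = c u x + negligible] gives [l ^ |beta|] times the derivative at [l x]
    on the left. Dividing by this power moves the bound from [L] to [l L], changing the constant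
    only. *)
Lemma dilate_bigO u (l : {posnum R}) (c : R[i]) (beta : 'I_d -> nat) N L :
  negligible_net U (EM_net (EM_dilate l u) - EM_net (c *: u)) ->
  compact L -> L `<=` U ->
  sup_bigO L (fun e x => normc (mpartial beta (u e) x)) (fun e => e ^- N) ->
  sup_bigO [set l%:num *: x | x in L]
    (fun e x => normc (mpartial beta (u e) x)) (fun e => e ^- N).
Proof.
move=> neg cL LU.
have pN e : 0 < e -> 0 <= e ^- N :> R by exact: expV_ge0.
have p0 e : 0 < e -> 0 <= e ^+ 0 :> R by exact: exp_pos_ge0.
move=> /(sup_bigOP _ _ pN)[c1 c10 h1].
(* The negligible remainder is bounded by a constant, and constants are dominated by multiples of
   [e ^- N] since [e <= 1]. *)
have /(sup_bigOP _ _ p0)[c2 c20 h2] := neg L cL LU beta 0%N.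
have ln0 : 0 < l%:num ^+ size (directions beta) by rewrite exprn_gt0.
apply/(sup_bigOP _ _ pN).
exists (l%:num ^- size (directions beta) * (normc c * c1 + c2)).
  by rewrite mulr_ge0 ?invr_ge0 ?(ltW ln0)// addr_ge0// mulr_ge0// normc_ge0.
have [su _] := EM_moderate u.
near=> e => _ [x Lx <-].
have e01 : 0 < e <= 1 by near: e; exact: near_unit_interval.
have e1 : 1 <= e ^- N by have := expV_le (leq0n N) e01; rewrite expr0 invr1.
rewrite -mulrA ler_pdivlMl//.
have dilE : (l%:num ^+ size (directions beta))%:C * mpartial beta (u e) (l%:num *: x) =
    c * mpartial beta (u e) x +
    mpartial beta ((EM_net (EM_dilate l u) - EM_net (c *: u)) e) x.
  have -> : (EM_net (EM_dilate l u) - EM_net (c *: u)) e =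
      (- c) *: (u e) + (fun y => u e (l%:num *: y)).
    by apply/funext => y; rewrite addrC scaleNr.
  have [sr si] := su e e01.
  have sd : csmooth U (fun y => u e (l%:num *: y)).
    by split; [move: sr|move: si]; apply: rsmooth_dil;
      solve [exact: openset_open|exact: puncturedZ].
  rewrite /mpartial (cpartials_lin _ _ (@openset_open _ _ U) (su e e01) sd (LU _ Lx)).
  by rewrite mulNr addNKr (cpartials_dil _ (@puncturedZ _ _ l) (su e e01) (LU _ Lx)).
rewrite -[l%:num ^+ _]ger0_norm ?(ltW ln0)// -normc_real -normcM dilE.
apply: (le_trans (le_normcD _ _)); rewrite normcM mulrDl -mulrA lerD//.
  by rewrite ler_wpM2l ?normc_ge0//; move: x Lx {dilE}; near: e.
apply: (@le_trans _ _ (c2 * e ^+ 0)).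
  by move: x Lx {dilE}; near: e.
by rewrite expr0 ler_wpM2l.
Unshelve. all: by end_near. Qed.

Lemma homogeneous_bigO u (c : {posnum R} -> R[i]) (beta : 'I_d -> nat) :
  (forall l, negligible_net U (EM_net (EM_dilate l u) - EM_net (c l *: u))) ->
  exists N : nat, forall L, compact L -> L `<=` U ->
    sup_bigO L (fun e x => normc (mpartial beta (u e) x)) (fun e => e ^- N).
Proof.
move=> neg; have [su hu] := EM_moderate u.
(* The exponent is read off on the annulus [1/2 <= |x| <= 2] and kept for all larger ones. *)
have [N hN] := hu _ (@annulus_compact R d 1) (@annulus_punctured R d 1) beta.
exists N; have pN e : 0 < e -> 0 <= e ^- N :> R by exact: expV_ge0.
have an k : sup_bigO (annulus k.+1 : set V)
    (fun e x => normc (mpartial beta (u e) x)) (fun e => e ^- N).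
  elim: k => [//|k IH].
  have step l := dilate_bigO (neg l) (@annulus_compact R d k.+1)
    (@annulus_punctured R d k.+1) IH.
  pose two := PosNum (ltr0Sn R 1).
  pose half := PosNum (divr_gt0 (ltr01 : 0 < 1 :> R) (ltr0Sn R 1)).
  have /(sup_bigOP _ _ pN)[c1 c10 h1] := step two.
  have /(sup_bigOP _ _ pN)[c2 c20 h2] := step half.
  apply/(sup_bigOP _ _ pN); exists (Num.max c1 c2); first by rewrite le_max c10.
  near=> e => x xk.
  have [ax|ax] := annulusS (ltn0Sn k) xk.
    apply: (@le_trans _ _ (c1 * e ^- N)); last by rewrite ler_wpM2r ?pN// le_max lexx.
    have : [set two%:num *: y | y in annulus k.+1] x.
      by exists (2^-1 *: x) => //=; rewrite scalerA divff// scale1r.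
    by move: x {xk ax}; near: e.
  apply: (@le_trans _ _ (c2 * e ^- N)); last first.
    by rewrite ler_wpM2r ?pN// le_max lexx orbT.
  have : [set half%:num *: y | y in annulus k.+1] x.
    by exists (2 *: x) => //=; rewrite scalerA div1r mulVf// scale1r.
  by move: x {xk ax}; near: e.
move=> L cL LU; have [k Lk] := compact_annulus cL LU.
have /(sup_bigOP _ _ pN)[c1 c10 h1] := an k.
apply/(sup_bigOP _ _ pN); exists c1 => //; apply: filterS h1 => e h1 x Lx.
by apply: h1; apply: (@shell_annulus _ _ k.+1) => //; exact/annulus_shell/Lk.
Unshelve. all: by end_near. Qed.

Lemma Re_le_normc (z : R[i]) : `|complex.Re z| <= normc z.
Proof.
case: z => a b /=; rewrite -sqrtr_sqr ler_wsqrtr// lerDl sqr_ge0//.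
Qed.

Lemma Im_le_normc (z : R[i]) : `|complex.Im z| <= normc z.
Proof.
case: z => a b /=; rewrite -sqrtr_sqr ler_wsqrtr// lerDr sqr_ge0//.
Qed.

Lemma normc_le_ReIm (z : R[i]) : normc z <= `|complex.Re z| + `|complex.Im z|.
Proof.
case: z => a b /=.
rewrite -[leRHS]ger0_norm ?addr_ge0// -sqrtr_sqr ler_wsqrtr//.
rewrite sqrrD !real_normK ?num_real// lerD2r lerDl.
by rewrite mulrn_wge0// mulr_ge0.
Qed.

Lemma ReM_real (a : R) (z : R[i]) : complex.Re (a%:C * z) = a * complex.Re z.
Proof. by case: z => x y; rewrite /= mul0r subr0. Qed.

Lemma ImM_real (a : R) (z : R[i]) : complex.Im (a%:C * z) = a * complex.Im z.
Proof. by case: z => x y; rewrite /= mul0r addr0. Qed.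

Definition cmul (chi : V -> R) (f : V -> R[i]^o) : V -> R[i]^o :=
  fun y => (chi y)%:C * f y.

Lemma cpartials_cmul s chi f x : cpartials s (cmul chi f) x =
  partials s (fun y => chi y * complex.Re (f y)) x +i*
  partials s (fun y => chi y * complex.Im (f y)) x.
Proof.
by rewrite /cpartials /cmul; under eq_fun do rewrite ReM_real;
  under [in X in _ +i* X]eq_fun do rewrite ImM_real.
Qed.

(** The real product estimate is applied to the real and imaginary parts of [u]. Its hypothesis on
    sublists holds because they are again lists of multi-indices. *)
Lemma uniform_bigOM u (beta : 'I_d -> nat) :
  (forall beta', exists N : nat, forall L, compact L -> L `<=` U ->
     sup_bigO L (fun e x => normc (mpartial beta' (u e) x)) (fun e => e ^- N)) ->
  exists N : nat, forall chi, rsmooth U chi -> forall L, compact L -> L `<=` U ->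
  \forall e \near 0^'+, forall x, L x ->
    normc (cpartials (directions beta) (cmul chi (u e)) x) <= e ^- N.
Proof.
move=> hu; have [su _] := EM_moderate u.
have hs s : subseq s (directions beta) ->
    uniform_order U s (fun e y => complex.Re (u e y)) /\
    uniform_order U s (fun e y => complex.Im (u e y)).
  move=> /subseq_directions[b ->]; have [N hN] := hu b.
  have pN e : 0 < e -> 0 <= e ^- N :> R by exact: expV_ge0.
  have {}hN L : compact L -> L `<=` U -> \forall e \near 0^'+,
      forall x, L x -> normc (mpartial b (u e) x) <= e ^- N.+1.
    move=> cL LU; have /(sup_bigOP _ _ pN)[c1 c10 h1] := hN L cL LU.
    apply: filterS2 h1 (near_absorb c1 N) => e h1 h2 x Lx.
    exact: le_trans (h1 x Lx) h2.
  split; exists N.+1 => L cL LU; apply: filterS (hN L cL LU) => e he x Lx.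
    exact: le_trans (Re_le_normc (mpartial b (u e) x)) (he x Lx).
  exact: le_trans (Im_le_normc (mpartial b (u e) x)) (he x Lx).
have oU := @openset_open _ _ U.
have [N1 h1] := uniform_orderM oU (fun e e01 => (su e e01).1)
  (fun s hss => (hs s hss).1).
have [N2 h2] := uniform_orderM oU (fun e e01 => (su e e01).2)
  (fun s hss => (hs s hss).2).
exists (maxn N1 N2).+1 => chi schi L cL LU; near=> e => x Lx.
have e01 : 0 < e <= 1 by near: e; exact: near_unit_interval.
rewrite cpartials_cmul; apply: (le_trans (normc_le_ReIm _)) => /=.
apply: (@le_trans _ _ (2 * e ^- (maxn N1 N2))); last by near: e; exact: near_absorb.
rewrite mulr_natl mulr2n lerD//.
  apply: (@le_trans _ _ (e ^- N1)); last by rewrite expV_le// leq_maxl.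
  by move: x Lx; near: e; exact: h1.
apply: (@le_trans _ _ (e ^- N2)); last by rewrite expV_le// leq_maxr.
by move: x Lx; near: e; exact: h2.
Unshelve. all: by end_near. Qed.

Lemma cutoff_cpartials0 k s (f : V -> R[i]^o) x : ~ annulus k.+1 x ->
  cpartials s (cmul (cutoff k) f) x = 0.
Proof.
move=> xk; have oA : open (~` (annulus k.+1 : set V)).
  by apply: closed_openC; exact: annulus_closed.
by rewrite cpartials_cmul !(partials_zero s oA)// => y yk; rewrite cutoff0 ?mul0r.
Qed.

(** The space is covered by two open sets: the punctured space, where both factors are smooth, and
    the complement of [annulus k.+1], where the product is 0. *)
Lemma csmooth_cutoff k (f : V -> R[i]^o) : csmooth U f ->
  csmooth setT (cmul (cutoff k) f).
Proof.
have oA : open (~` (annulus k.+1 : set V)).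
  by apply: closed_openC; exact: annulus_closed.
have oU := @openset_open _ _ U.
have sM (g : V -> R) : rsmooth U g -> rsmooth setT (fun y => cutoff k y * g y).
  move=> sg s x _; have [xk|xk] := pselect (annulus k.+1 x).
    apply: (@rsmoothM _ _ U) => //; last exact: annulus_punctured xk.
    exact: rsmooth_cutoff.
  apply: (@eq_rsmooth _ _ _ (fun=> 0) _ oA) => //; last exact: rsmooth_cst.
  by move=> y /set_mem yk; rewrite cutoff0 ?mul0r.
move=> [fr fi]; split; rewrite /cmul.
  by under eq_fun do rewrite ReM_real; exact: sM.
by under eq_fun do rewrite ImM_real; exact: sM.
Qed.

(** Exponents independent of the compact set allow the cutoff index to grow with [1/e] without
    affecting the order of any derivative. *)
Lemma uniform_bigO_extension u :
  (forall beta, exists N : nat, forall L, compact L -> L `<=` U ->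
     sup_bigO L (fun e x => normc (mpartial beta (u e) x)) (fun e => e ^- N)) ->
  exists v : tempered (fullspace R d),
    colombeau_restrict (sub_fullspace U) (tempered_to_colombeau v) =
    \pi_(colombeau U) u.
Proof.
move=> hu; have [su _] := EM_moderate u.
(* Exponents are indexed by lists, which can be enumerated by [pickle]; lists not coming from a
   multi-index get the default 0. *)
have /choice[N hN] : forall s, exists N : nat, (exists beta, s = directions beta) ->
    forall k, \forall e \near 0^'+, forall x, annulus k.+1 x ->
    normc (cpartials s (cmul (cutoff k) (u e)) x) <= e ^- N.
  move=> s; have [[beta ->]|ns] := pselect (exists beta, s = directions beta);
    last by exists 0%N.
  have [N hN] := uniform_bigOM beta hu; exists N => _ k; apply: hN.
  - by apply: rsmooth_cutoff; exact: openset_open.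
  - exact: annulus_compact.
  - exact: annulus_punctured.
(* Only lists with code at most [k] are controlled: these are finitely many, so [P k e] holds for
   small [e], and every list is reached once [K e] exceeds its code. *)
pose P k e := forall j, (j <= k)%N -> forall s, unpickle j = Some s ->
  (exists beta, s = directions beta) -> forall x, annulus k.+1 x ->
  normc (cpartials s (cmul (cutoff k) (u e)) x) <= e ^- N s.
have [|K [PK Koo]] := @slow_index R P.
  move=> k; apply: near_forall_leq => j.
  case: (unpickle j) => [s|]; last by near=> e.
  have [sb|nsb] := pselect (exists beta, s = directions beta); last first.
    by near=> e => _ [<-].
  by apply: filterS (hN s sb k) => e he _ [<-] _.
pose v e := cmul (cutoff (K e)) (u e).
have vM : v \in EM_tau_pred (fullspace R d).
  apply/asboolP; split=> [e e01|beta]; first exact/csmooth_cutoff/su.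
  exists (N (directions beta)).
  apply/sup_bigOP; first exact: expV_ge0.
  exists 1 => //; near=> e => x _.
  have e0 : 0 < e by [].
  (* The weight is at most 1, so it is enough to bound the derivative itself on the whole space: by
     [P] on [annulus (K e).+1], by 0 outside. *)
  apply: (@le_trans _ _ (normc (mpartial beta (v e) x))).
    rewrite ler_piMl ?normc_ge0//.
    by have := weight_le x (leq0n (N (directions beta))); rewrite expr0 invr1.
  rewrite mul1r /mpartial /v.
  have [xk|xk] := pselect (annulus (K e).+1 x); last first.
    by rewrite cutoff_cpartials0// normc0' expV_ge0.
  have : P (K e) e by near: e.
  apply; [|exact: pickleK|by exists beta|exact: xk].
  by near: e; exact: Koo.
exists (\pi_(tempered (fullspace R d)) (MkEM_tau vM)).
rewrite tempered_to_colombeau_pi colombeau_restrict_pi.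
apply/colombeau_eqP => L cL LU beta m.
have [k Lk] := compact_annulus cL LU.
apply/sup_bigOP; first exact: exp_pos_ge0.
(* The constant 0 is possible because the two nets coincide near [L] for small [e]. *)
exists 0 => //; near=> e => x Lx.
(* The index [k.+1] rather than [k] makes the cutoff equal to 1 on the open set [shell k.+1] around
   [L], so that all derivatives of the difference vanish on [L]. *)
have kK : (k.+1 <= K e)%N by near: e; exact: Koo.
have vu y : shell k.+1 y -> v e y - u e y = 0.
  by move=> yk; rewrite /v /cmul cutoff1 ?mul1r ?subrr//; exact: shell_annulus yk.
have sx : shell k.+1 x by exact/annulus_shell/Lk.
have oS := @shell_open R d k.+1.
rewrite mul0r (_ : mpartial _ _ _ = 0) ?normc0'//.
by congr (_ +i* _); apply: (partials_zero _ oS) sx => y /vu vuy;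
  [exact: (congr1 (@complex.Re R) vuy)|exact: (congr1 (@complex.Im R) vuy)].
Unshelve. all: by end_near. Qed.

End Extension.

Theorem corollary4p18 (R : realType) (d : nat) (hd : (1 <= d)%N) (alpha : R)
    (u : colombeau (punctured R d))
    (hu : forall lambda : {posnum R},
      colombeau_dilate lambda u = (lambda%:num `^ alpha)%:C *: u) :
  exists v : tempered (fullspace R d),
    colombeau_restrict (sub_fullspace (punctured R d))
      (tempered_to_colombeau v) = u.
Proof.
move: hu; elim/quotW: u => u hu.
apply: uniform_bigO_extension => beta.
apply: (homogeneous_bigO (c := fun l => (l%:num `^ alpha)%:C)) => l.
apply/colombeau_eqP.
by rewrite -colombeau_dilate_pi hu colombeau_scale_pi.
Qed.
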